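(* There is a unique family of homogeneous polynomials $\{\mathfrak{P}_F(\mathbf{x};\mathbf{t}) : F \text{ an indexed forest}\}\subset \mathbb{Z}[\mathbf{t}][\mathbf{x}]$ such that, writing $\widehat{\mathbf{t}}_i=(t_1,\dots,t_{i-1},t_{i+1},t_{i+2},\dots)$, for every indexed forest $F$ we have $$\mathfrak{P}_F(\mathbf{t};\mathbf{t})=\begin{cases}1 & F=\emptyset\\ 0 & \text{otherwise,}\end{cases}\qquad\text{and for every } i\ge 1:\qquad E_i\mathfrak{P}_F=\begin{cases}\mathfrak{P}_{F/i}(\mathbf{x};\widehat{\mathbf{t}}_i) & i\in \mathrm{Qdes}(F)\\ 0 & \text{otherwise.}\end{cases}$$
   Context: $\mathbf{x}=(x_1,x_2,\dots)$ and $\mathbf{t}=(t_1,t_2,\dots)$ are two infinite sets of commuting variables; homogeneity is with respect to total degree with $\deg x_i=\deg t_i=1$. $\mathfrak{P}_F(\mathbf{t};\mathbf{t})$ means substituting $x_i=t_i$ for all $i$, and $\mathfrak P_{F/i}(\mathbf x;\widehat{\mathbf t}_i)$ means substituting the sequence $\widehat{\mathbf t}_i$ for the sequence $\mathbf t$. For $f\in\mathbb Z[\mathbf t][\mathbf x]$ set $R_i^-f=f(x_1,\dots,x_{i-1},t_i,x_i,x_{i+1},\dots;\mathbf t)$, $R_i^+f=f(x_1,\dots,x_{i-1},x_i,t_i,x_{i+1},\dots;\mathbf t)$ (insert $t_i$ in position $i$, resp. $i+1$, shifting later $x$'s up), and $E_if=(R_i^+f-R_i^-f)/(x_i-t_i)$.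 Indexed forests: a binary plane tree is a rooted tree in which each node is either a leaf or an internal node with an ordered pair of children (left child, right child); the one-node tree is trivial. An indexed forest is a sequence $F=(T_1,T_2,\dots)$ of binary plane trees, all but finitely many trivial. The leaves of $F$ are identified with $\mathbb N=\{1,2,\dots\}$ from left to right across all trees in order. $\emptyset$ is the forest with all trees trivial. An internal node is terminal if both its children are leaves. For an internal node $v$, $\rho_F(v)$ is the leaf reached from $v$ by repeatedly passing to the left child. $\mathrm{Qdes}(F)=\{\rho_F(v): v\text{ terminal}\}$. For $i\in\mathrm{Qdes}(F)$, $F/i$ is the indexed forest obtained by deleting the terminal node $v$ with $\rho_F(v)=i$ (replacing $v$ and its two leaves by a single leaf, and relabeling leaves left to right by $\mathbb N$). *)

(* Defs.v *)
From HB Require Import structures.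
From mathcomp Require Import all_boot all_algebra.
From mathcomp Require Import finmap.
From mathcomp.multinomials Require Import monalg.

Set Implicit Arguments.
Unset Strict Implicit.
Unset Printing Implicit Defensive.
Import GRing.Theory.
Local Open Scope ring_scope.

(* Leaves are numbered from 0 (the paper's leaf k is our leaf k-1).    *)
Inductive tree : Type := Leaf | Node of tree & tree.

Definition is_leaf (t : tree) : bool := if t is Leaf then true else false.

Fixpoint nleaves (t : tree) : nat :=
  match t with Leaf => 1%N | Node l r => (nleaves l + nleaves r)%N end.

(* A forest is represented by the finite list of its first trees, all    *)
(* subsequent trees being trivial; the list is normalised so that it     *)
(* does not end with a trivial tree.                                      *)
Definition trimmed (s : seq tree) : bool :=
  if s is [::] then true else ~~ is_leaf (last Leaf s).

Fixpoint trim (s : seq tree) : seq tree :=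
  match s with
  | [::] => [::]
  | t :: s' => let s'' := trim s' in
      if nilp s'' && is_leaf t then [::] else t :: s''
  end.

Lemma trim_trimmed s : trimmed (trim s).
Proof.
elim: s => [|t s IH] //=.
case: (trim s) IH => [|u s'] /= IH.
  by case: t.
by [].
Qed.

Definition forest := {s : seq tree | trimmed s}.

Definition empty_forest (F : forest) : bool := nilp (sval F).

(* rho-values of terminal nodes of a tree whose leftmost leaf is o *)
Fixpoint tqdes (t : tree) (o : nat) : seq nat :=
  match t with
  | Leaf => [::]
  | Node Leaf Leaf => [:: o]
  | Node l r => tqdes l o ++ tqdes r (o + nleaves l)
  end.

Fixpoint sqdes (s : seq tree) (o : nat) : seq nat :=
  match s with
  | [::] => [::]
  | t :: s' => tqdes t o ++ sqdes s' (o + nleaves t)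
  end.

Definition qdes (F : forest) : seq nat := sqdes (sval F) 0.

Fixpoint tdel (t : tree) (o i : nat) : tree :=
  match t with
  | Leaf => Leaf
  | Node l r =>
      if is_leaf l && is_leaf r && (o == i) then Leaf
      else Node (tdel l o i) (tdel r (o + nleaves l) i)
  end.

Fixpoint sdel (s : seq tree) (o i : nat) : seq tree :=
  match s with
  | [::] => [::]
  | t :: s' => tdel t o i :: sdel s' (o + nleaves t) i
  end.

(* F / i  (meaningful when i \in qdes F) *)
Definition fdel (F : forest) (i : nat) : forest :=
  exist _ (trim (sdel (sval F) 0 i)) (trim_trimmed _).

(* Polynomials in Z[t][x] = Z[x_0, x_1, ..., t_0, t_1, ...]           *)
(* variable (false, i) is x_i, variable (true, i) is t_i (0-based).   *)
Definition var_t := (bool * nat)%type.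
Definition xtpoly := {malg int[cmonom var_t]}.

Definition var (v : var_t) : xtpoly := << ucm v >>.
Definition X (i : nat) : xtpoly := var (false, i).
Definition T (i : nat) : xtpoly := var (true, i).

Definition homogeneous (p : xtpoly) : Prop :=
  exists d : nat, forall m, m \in msupp p -> mdeg m = d.

Definition subst (s : var_t -> xtpoly) (p : xtpoly) : xtpoly :=
  \sum_(m <- msupp p)
     (p@_m)%:MP * \prod_(v <- finsupp (m : {fsfun of _ : var_t => 0%N})) s v ^+ (m v).

Definition sub_xt (p : xtpoly) : xtpoly := subst (fun v => T v.2) p.

Definition sub_that (i : nat) (p : xtpoly) : xtpoly :=
  subst (fun v => if v.1 then (if (v.2 < i)%N then T v.2 else T v.2.+1)
                  else X v.2) p.

Definition Rminus (i : nat) (p : xtpoly) : xtpoly :=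
  subst (fun v => if v.1 then T v.2 else
           if (v.2 < i)%N then X v.2
           else if v.2 == i then T i else X v.2.-1) p.

Definition Rplus (i : nat) (p : xtpoly) : xtpoly :=
  subst (fun v => if v.1 then T v.2 else
           if (v.2 <= i)%N then X v.2
           else if v.2 == i.+1 then T i else X v.2.-1) p.

(* "E_i p = q", i.e. (R_i^+ p - R_i^- p)/(x_i - t_i) = q, stated as      *)
(* R_i^+ p - R_i^- p = (x_i - t_i) * q (x_i - t_i is a non-zero-divisor). *)
Definition E_eq (i : nat) (p q : xtpoly) : Prop :=
  Rplus i p - Rminus i p = (X i - T i) * q.

Definition forest_family (P : forest -> xtpoly) : Prop :=
  (forall F, homogeneous (P F)) /\
  (forall F, sub_xt (P F) = (if empty_forest F then 1 else 0)) /\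
  (forall F (i : nat),
      E_eq i (P F) (if i \in qdes F then sub_that i (P (fdel F i)) else 0)).

(* Main.v *)
Require Import Defs.
From HB Require Import structures.
From mathcomp Require Import all_boot all_algebra finmap zify ring.
From mathcomp.multinomials Require Import monalg.

(** Write [E_{k,u} p = q] for "inserting [u] at position [k+1] minus inserting
    [u] at position [k] in [p] equals [(x_k - u) q]"; then [E_i = E_{i,t_i}].

    If [f] only involves [x_0, ..., x_{n-1}], then [R^+_{n-1} f = f] while
    [R^-_{n-1} f] does not involve [x_{n-1}].  Hence a polynomial killed by all
    [E_i] involves no [x] at all and is determined by its value at [x = t]:
    this gives uniqueness by induction on the number of internal nodes.

    For existence, insertions at distant positions commute, so the [g_i = E_i f]
    satisfy [E_{j,t_{j+1}} g_i = E_{i,t_i} g_{j+1}] for [i < j].  Conversely this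
    compatibility is sufficient to solve [E_i f = g_i] for all [i]: with [n]
    variables, [f_1 = (x_{n-1} - t_{n-1}) g_{n-1}] satisfies the last equation,
    and compatibility shows that the remaining data [g_i - E_i f_1] live in one
    variable less.  For the forest data [g_i = P_{F/i}(x; t-hat_i)] compatibility
    is the relation [(F/i)/j = (F/(j+1))/i]; subtracting [f(t;t)] normalises the
    solution. *)

Set Implicit Arguments.
Unset Strict Implicit.
Unset Printing Implicit Defensive.
Import GRing.Theory.

(** * Forests *)

Fixpoint tnodes (t : tree) : nat :=
  if t is Node l r then (tnodes l + tnodes r).+1 else 0.

Lemma nleaves_gt0 t : 0 < nleaves t.
Proof. by elim: t => //= l IHl r IHr; rewrite addn_gt0 IHl. Qed.

Lemma tqdes_Node l r o : tqdes (Node l r) o =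
  if is_leaf l && is_leaf r then [:: o]
  else tqdes l o ++ tqdes r (o + nleaves l).
Proof. by case: l => [|? ?] //; case: r. Qed.

Lemma tqdes_Node_neq l r o k : k != o ->
  (k \in tqdes (Node l r) o) =
  (k \in tqdes l o) || (k \in tqdes r (o + nleaves l)).
Proof.
move=> neq_ko; rewrite tqdes_Node; case: ifP => [|_]; last by rewrite mem_cat.
by case: l => //; case: r => // _; rewrite inE (negbTE neq_ko).
Qed.

Lemma tqdes_bound t o i : i \in tqdes t o -> o <= i /\ i.+1 < o + nleaves t.
Proof.
elim: t o => [//|l IHl r IHr] o; rewrite tqdes_Node; case: ifP => _ /=.
  by rewrite inE => /eqP->; have := nleaves_gt0 l; have := nleaves_gt0 r; lia.
by rewrite mem_cat => /orP[/IHl|/IHr]; lia.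
Qed.

Lemma tqdes_out t o k : k < o \/ o + nleaves t <= k.+1 ->
  (k \in tqdes t o) = false.
Proof. by move=> out; apply/negP => /tqdes_bound; lia. Qed.

Lemma tqdes_is_leaf t o i : i \in tqdes t o -> is_leaf t = false.
Proof. by case: t. Qed.

Lemma tdel_id t o i : i \notin tqdes t o -> tdel t o i = t.
Proof.
elim: t o => [//|l IHl r IHr] o; rewrite tqdes_Node /=.
case lf: (_ && _) => /=.
  by rewrite inE eq_sym => /negbTE->; case: l r lf {IHl IHr} => // -[].
by rewrite mem_cat negb_or => /andP[/IHl-> /IHr->].
Qed.

Lemma tdel_out t o i : i < o \/ o + nleaves t <= i.+1 -> tdel t o i = t.
Proof. by move=> out; rewrite tdel_id ?tqdes_out. Qed.

Lemma tdel_Node l r o i : is_leaf l && is_leaf r = false ->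
  tdel (Node l r) o i = Node (tdel l o i) (tdel r (o + nleaves l) i).
Proof. by move=> /= ->. Qed.

Lemma tqdes_shift t o k : (k.+1 \in tqdes t o.+1) = (k \in tqdes t o).
Proof.
elim: t o => [//|l IHl r IHr] o; rewrite !tqdes_Node.
by case: ifP => _; rewrite ?inE ?eqSS // !mem_cat IHl addSn IHr.
Qed.

Lemma tdel_shift t o i : tdel t o.+1 i.+1 = tdel t o i.
Proof. by elim: t o => [//|l IHl r IHr] o /=; rewrite eqSS IHl addSn IHr. Qed.

Lemma nleaves_tdel t o i :
  i \in tqdes t o -> nleaves t = (nleaves (tdel t o i)).+1.
Proof.
elim: t o => [//|l IHl r IHr] o; rewrite tqdes_Node.
case: ifP => [|nlf]; first by case: l IHl => //; case: r IHr => //= _ _ _;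
  rewrite inE => /eqP->; rewrite eqxx.
rewrite mem_cat tdel_Node //= => /orP[il|ir].
  have [le_o lt_i] := tqdes_bound il.
  by rewrite (@tdel_out r) ?[in LHS](IHl _ il) //; left; lia.
have [le_o lt_i] := tqdes_bound ir.
by rewrite (@tdel_out l) ?[in LHS](IHr _ ir) ?addnS //; right; lia.
Qed.

Lemma is_leaf_tdel t o i :
  i \in tqdes t o -> is_leaf (tdel t o i) -> i = o.
Proof.
move=> it; have := tqdes_bound it; rewrite (nleaves_tdel it).
by case: tdel => //=; lia.
Qed.

Lemma tnodes_tdel t o i :
  i \in tqdes t o -> tnodes t = (tnodes (tdel t o i)).+1.
Proof.
elim: t o => [//|l IHl r IHr] o; rewrite tqdes_Node.
case: ifP => [|nlf]; first by case: l IHl => //; case: r IHr => //= _ _ _;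
  rewrite inE => /eqP->; rewrite eqxx.
rewrite mem_cat tdel_Node //= => /orP[il|ir].
  have [le_o lt_i] := tqdes_bound il.
  by rewrite (@tdel_out r) ?[in LHS](IHl _ il) //; left; lia.
have [le_o lt_i] := tqdes_bound ir.
by rewrite (@tdel_out l) ?[in LHS](IHr _ ir) ?addnS //; right; lia.
Qed.

(** Deletion merges leaves [i] and [i.+1], so later leaves move down by one. At [k = i] the claim
    can fail: the merged leaf may make its parent terminal. *)
Lemma tqdes_tdel_gt t o i k : i \in tqdes t o -> i < k ->
  (k \in tqdes (tdel t o i) o) = (k.+1 \in tqdes t o).
Proof.
elim: t o => [//|l IHl r IHr] o it ltik.
have [leoi _] := tqdes_bound it.
move: it; rewrite {1}tqdes_Node; case: ifP => [|nlf].
  case: l IHl => //; case: r IHr => //= _ _ _.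
  by rewrite inE => /eqP eio; rewrite eio eqxx !inE; lia.
rewrite mem_cat tdel_Node // => /orP[il|ir].
  have [_ lt_i] := tqdes_bound il.
  rewrite (@tdel_out r); last by left; lia.
  rewrite !tqdes_Node_neq ?IHl ?(nleaves_tdel il) ?addnS ?tqdes_shift //; lia.
have [le_o lt_i] := tqdes_bound ir.
rewrite (@tdel_out l); last by right; lia.
by rewrite !tqdes_Node_neq ?IHr // ?(@tqdes_out l) //; lia.
Qed.

(** The value [k.+1 = i] is excluded because the merged leaf may be the right child of a new
    terminal node at [k]. *)
Lemma tqdes_tdel_lt t o i k : i \in tqdes t o -> k.+1 < i ->
  (k \in tqdes (tdel t o i) o) = (k \in tqdes t o).
Proof.
elim: t o => [//|l IHl r IHr] o it ltik.
move: (it); rewrite {1}tqdes_Node; case: ifP => [|nlf].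
  case: l IHl it => //; case: r IHr => //= _ _ _ _.
  by rewrite inE => /eqP eio; rewrite eio eqxx !inE; lia.
rewrite mem_cat tdel_Node // => /orP[il|ir].
  have [leoi lt_i] := tqdes_bound il.
  rewrite (@tdel_out r); last by left; lia.
  (* At [k = o] the node itself might have become terminal; but [l] collapses to a leaf only if
     [i = o], against [k.+1 < i]. *)
  have [eq_ko|neq_ko] := eqVneq k o; last first.
    rewrite !tqdes_Node_neq ?IHl //; congr (_ || _).
    by rewrite !tqdes_out //; have := nleaves_tdel il; lia.
  rewrite !tqdes_Node nlf ifF; last first.
    by apply/negP => /andP[/(is_leaf_tdel il)]; lia.
  rewrite !mem_cat IHl //; congr (_ || _).
  by rewrite !tqdes_out //; have := nleaves_tdel il; lia.
have [le_o lt_i] := tqdes_bound ir.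
rewrite (@tdel_out l); last by right; lia.
have [eq_ko|neq_ko] := eqVneq k o; last by rewrite !tqdes_Node_neq ?IHr.
rewrite !tqdes_Node nlf ifF ?mem_cat ?IHr //.
apply/negP => /andP[leaf_l /(is_leaf_tdel ir)].
by case: l leaf_l {IHl it nlf ir le_o lt_i} => //=; lia.
Qed.

(** Distinct terminal nodes share no leaf, so their deletions commute; the one at [j.+1] is found at
    [j] once the one at [i] is gone. *)
Lemma tdel_tdel t o i j : i \in tqdes t o -> j.+1 \in tqdes t o -> i < j ->
  tdel (tdel t o i) o j = tdel (tdel t o j.+1) o i.
Proof.
elim: t o => [//|l IHl r IHr] o it jt ltij.
move: it jt; rewrite !tqdes_Node; case: ifP => [_|nlf].
  by rewrite !inE; lia.
rewrite !mem_cat => /orP[il|ir] /orP[jl'|jr].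
- have [leoi lt_i] := tqdes_bound il; have [leoj lt_j] := tqdes_bound jl'.
  have il2 : i \in tqdes (tdel l o j.+1) o by rewrite tqdes_tdel_lt.
  have jl2 : j \in tqdes (tdel l o i) o by rewrite tqdes_tdel_gt.
  rewrite !tdel_Node ?(tqdes_is_leaf il2) ?(tqdes_is_leaf jl2) //.
  have := nleaves_tdel il; have := nleaves_tdel jl' => n1 n2.
  by rewrite IHl // !(@tdel_out r) //; left; lia.
- have [leoi lt_i] := tqdes_bound il; have [leoj lt_j] := tqdes_bound jr.
  have nl := nleaves_tdel il.
  rewrite !(tdel_Node _ _ nlf) (@tdel_out r _ i); last by left; lia.
  rewrite (@tdel_out l _ j.+1); last by right; lia.
  rewrite !tdel_Node ?(tqdes_is_leaf il) ?(tqdes_is_leaf jr) ?andbF //.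
  rewrite (@tdel_out (tdel l o i)); last by right; lia.
  rewrite (@tdel_out (tdel r _ j.+1)); last by left; lia.
  (* The left subtree has lost a leaf, so the offset of [r] and the deleted leaf both drop by
     one. *)
  by rewrite nl addnS tdel_shift.
- by have := tqdes_bound ir; have := tqdes_bound jl'; lia.
- have [leoi lt_i] := tqdes_bound ir; have [leoj lt_j] := tqdes_bound jr.
  have il2 : i \in tqdes (tdel r (o + nleaves l) j.+1) (o + nleaves l).
    by rewrite tqdes_tdel_lt.
  have jl2 : j \in tqdes (tdel r (o + nleaves l) i) (o + nleaves l).
    by rewrite tqdes_tdel_gt.
  rewrite !tdel_Node ?(tqdes_is_leaf il2) ?(tqdes_is_leaf jl2) ?andbF //.
  rewrite (@tdel_out l _ i); last by right; lia.
  rewrite (@tdel_out l _ j.+1); last by right; lia.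
  rewrite (@tdel_out l _ i); last by right; lia.
  rewrite (@tdel_out l _ j); last by right; lia.
  by rewrite IHr.
Qed.

(** * Sequences of trees and forests *)

Definition snodes (s : seq tree) : nat := sumn (map tnodes s).

Lemma sqdes_ge s o i : i \in sqdes s o -> o <= i.
Proof.
elim: s o => [//|t s IH] o /=; rewrite mem_cat => /orP[/tqdes_bound[] //|].
by move/IH; apply: leq_trans; apply: leq_addr.
Qed.

Lemma sqdes_lt s o k : k < o -> (k \in sqdes s o) = false.
Proof. by move=> ltko; apply/negP => /sqdes_ge; lia. Qed.

Lemma sdel_lt s o i : i < o -> sdel s o i = s.
Proof.
elim: s o => [//|t s IH] o lt_io /=.
by rewrite tdel_out ?IH //; [lia|left].
Qed.

Lemma sqdes_shift s o k : (k.+1 \in sqdes s o.+1) = (k \in sqdes s o).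
Proof. by elim: s o => [//|t s IH] o /=; rewrite !mem_cat tqdes_shift addSn IH. Qed.

Lemma sdel_shift s o i : sdel s o.+1 i.+1 = sdel s o i.
Proof. by elim: s o => [//|t s IH] o /=; rewrite tdel_shift addSn IH. Qed.

Lemma snodes_sdel s o i :
  i \in sqdes s o -> snodes s = (snodes (sdel s o i)).+1.
Proof.
rewrite /snodes; elim: s o => [//|t s IH] o /=; rewrite mem_cat => /orP[it|si].
  have [_ lt_i] := tqdes_bound it.
  by rewrite sdel_lt ?(tnodes_tdel it) //; lia.
by rewrite (IH _ si) tdel_out ?addnS //; have := sqdes_ge si; lia.
Qed.

Lemma sqdes_sdel_gt s o i k : i \in sqdes s o -> i < k ->
  (k \in sqdes (sdel s o i) o) = (k.+1 \in sqdes s o).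
Proof.
elim: s o => [//|t s IH] o /=; rewrite mem_cat => /orP[it|si] ltik.
  have [_ lt_i] := tqdes_bound it.
  rewrite sdel_lt; last by lia.
  by rewrite !mem_cat tqdes_tdel_gt // (nleaves_tdel it) addnS sqdes_shift.
have lei := sqdes_ge si.
rewrite tdel_out; last by right; lia.
by rewrite !mem_cat !tqdes_out ?IH //; lia.
Qed.

Lemma sqdes_sdel_lt s o i k : i \in sqdes s o -> k.+1 < i ->
  (k \in sqdes (sdel s o i) o) = (k \in sqdes s o).
Proof.
elim: s o => [//|t s IH] o /=; rewrite mem_cat => /orP[it|si] ltik.
  have [_ lt_i] := tqdes_bound it; have nt := nleaves_tdel it.
  by rewrite !mem_cat tqdes_tdel_lt // !sqdes_lt //; lia.
have lei := sqdes_ge si.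
by rewrite tdel_out ?mem_cat ?IH //; right; lia.
Qed.

Lemma sdel_sdel s o i j : i \in sqdes s o -> j.+1 \in sqdes s o -> i < j ->
  sdel (sdel s o i) o j = sdel (sdel s o j.+1) o i.
Proof.
elim: s o => [//|t s IH] o /=; rewrite !mem_cat => /orP[it|si] /orP[jt|js] ltij.
- have bi := tqdes_bound it; have bj := tqdes_bound jt.
  have ni := nleaves_tdel it; have nj := nleaves_tdel jt.
  by rewrite tdel_tdel // !sdel_lt //; lia.
- have bi := tqdes_bound it; have bj := sqdes_ge js; have ni := nleaves_tdel it.
  rewrite (@sdel_lt s _ i); last by lia.
  rewrite (@tdel_out t _ j.+1); last by right; lia.
  rewrite (@tdel_out (tdel t o i)); last by right; lia.
  rewrite (@sdel_lt (sdel s _ _)); last by lia.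
  by rewrite ni addnS sdel_shift.
- by have := tqdes_bound jt; have := sqdes_ge si; lia.
- have bi := sqdes_ge si; have bj := sqdes_ge js.
  rewrite (@tdel_out t _ i); last by right; lia.
  rewrite (@tdel_out t _ j.+1); last by right; lia.
  rewrite (@tdel_out t _ i); last by right; lia.
  rewrite (@tdel_out t _ j); last by right; lia.
  by rewrite IH.
Qed.

Lemma sqdes_trim s o : sqdes (trim s) o = sqdes s o.
Proof.
elim: s o => [//|t s IH] o /=; case: ifP => [|_] /=; last by rewrite IH.
by case: t => [|? ?]; rewrite ?andbF // -IH; case: (trim s).
Qed.

Lemma snodes_trim s : snodes (trim s) = snodes s.
Proof.
rewrite /snodes; elim: s => [//|t s IH] /=; case: ifP => [|_] /=; last by rewrite IH.
by case: t => [|? ?]; rewrite ?andbF // -IH; case: (trim s).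
Qed.

Lemma trim_sdel_trim s o i : trim (sdel (trim s) o i) = trim (sdel s o i).
Proof.
elim: s o => [//|t s IH] o /=; case: ifP => [|_] /=; last by rewrite IH.
case: t => [|? ?]; rewrite ?andbF // andbT => /nilP ts0 /=.
by rewrite -IH ts0.
Qed.

Definition fsize (F : forest) : nat := snodes (sval F).

Lemma qdes_fdel_gt F i k : i \in qdes F -> i < k ->
  (k \in qdes (fdel F i)) = (k.+1 \in qdes F).
Proof. by move=> iF ltik; rewrite /qdes /= sqdes_trim sqdes_sdel_gt. Qed.

Lemma qdes_fdel_lt F i k : i \in qdes F -> k.+1 < i ->
  (k \in qdes (fdel F i)) = (k \in qdes F).
Proof. by move=> iF ltik; rewrite /qdes /= sqdes_trim sqdes_sdel_lt. Qed.

Lemma fdel_fdel F i j : i \in qdes F -> j.+1 \in qdes F -> i < j ->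
  fdel (fdel F i) j = fdel (fdel F j.+1) i.
Proof.
by move=> iF jF ltij; apply: val_inj; rewrite /= !trim_sdel_trim sdel_sdel.
Qed.

Lemma fsize_fdel F i : i \in qdes F -> fsize F = (fsize (fdel F i)).+1.
Proof. by move=> iF; rewrite /fsize /= snodes_trim (snodes_sdel iF). Qed.

(** A nonempty trimmed list ends with a nontrivial tree, which has an internal node. *)
Lemma empty_forestE F : empty_forest F = (fsize F == 0).
Proof.
case: F => s; rewrite /empty_forest /fsize /snodes /=.
case/lastP: s => [//|s t].
have -> : trimmed (rcons s t) = ~~ is_leaf t.
  by case: s => [//|u s]; rewrite /= last_rcons.
by case: t => // l r _; rewrite map_rcons sumn_rcons addnS; case: s.
Qed.

Local Open Scope ring_scope.

(** * Solving [E_i f = g_i] *)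

(* The polynomial ring enters only through its universal property and
   cancellation of variables; working with an abstract [A] keeps unification
   from unfolding the monoid algebra. *)
Section Reconstruction.

Variables (A : comNzRingType) (x : var_t -> A).
Variable ev : (var_t -> A) -> {rmorphism A -> A}.
Hypothesis ev_var : forall s v, ev s (x v) = s v.
Hypothesis var_ind : forall K : A -> Prop,
  K 1 -> (forall p q, K p -> K q -> K (p - q)) ->
  (forall v p, K p -> K (x v * p)) -> forall p, K p.

Local Notation X i := (x (false, i)).
Local Notation T i := (x (true, i)).

Hypothesis mulIvar : forall v p, x v * p = 0 -> p = 0.

Implicit Types (i j k n d : nat) (p q u f : A) (s : var_t -> A) (v : var_t).

Lemma ev_ext s s' p : s =1 s' -> ev s p = ev s' p.
Proof.
move=> eq_s; elim/var_ind: p => [|p q IHp IHq|v p IH].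
- by rewrite !rmorph1.
- by rewrite !rmorphB IHp IHq.
- by rewrite !rmorphM IH !ev_var eq_s.
Qed.

Lemma ev_comp s s' p : ev s (ev s' p) = ev (fun v => ev s (s' v)) p.
Proof.
elim/var_ind: p => [|p q IHp IHq|v p IH].
- by rewrite !rmorph1.
- by rewrite !rmorphB IHp IHq.
- by rewrite !rmorphM IH !ev_var.
Qed.

Lemma ev_id s p : s =1 x -> ev s p = p.
Proof.
move=> eq_s; elim/var_ind: p => [|p q IHp IHq|v p IH].
- by rewrite !rmorph1.
- by rewrite !rmorphB IHp IHq.
- by rewrite !rmorphM IH !ev_var eq_s.
Qed.

(* The translation [x_i |-> x_i + t_k] turns [x_i - t_k] into a variable. *)
Lemma mulIXB i k p q : (X i - T k) * p = (X i - T k) * q -> p = q.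
Proof.
pose tr (c : A) v := if v == (false, i) then X i + c else x v.
have trK : cancel (ev (tr (T k))) (ev (tr (- T k))).
  move=> r; rewrite ev_comp ev_id // => v; rewrite /tr.
  case: eqP => [->|/eqP/negbTE nv]; last by rewrite ev_var nv.
  by rewrite rmorphD !ev_var eqxx /= addrNK.
move/eqP; rewrite -subr_eq0 -mulrBr => /eqP /(congr1 (ev (tr (T k)))).
rewrite rmorphM rmorph0 rmorphB !ev_var /tr eqxx /= addrK.
move/mulIvar/(congr1 (ev (tr (- T k)))).
by rewrite trK rmorph0 => /eqP; rewrite subr_eq0 => /eqP.
Qed.

(** The constructors mirror [var_ind]; closure under subtraction puts 0 in every degree. *)
Inductive hom : nat -> A -> Prop :=
| hom1 : hom 0 1
| homB d p q : hom d p -> hom d q -> hom d (p - q)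
| homX d v p : hom d p -> hom d.+1 (x v * p).

Lemma homx v : hom 1 (x v).
Proof. by rewrite -[x v]mulr1; apply/homX/hom1. Qed.

Lemma hom0 d : hom d 0.
Proof.
suff [p hp] : exists p, hom d p by rewrite -(subrr p); apply: homB.
elim: d => [|d [p hp]]; first by exists 1; apply: hom1.
by exists (X 0 * p); apply: homX.
Qed.

Lemma homN d p : hom d p -> hom d (- p).
Proof. by move=> hp; rewrite -sub0r; apply: homB => //; apply: hom0. Qed.

Lemma homD d p q : hom d p -> hom d q -> hom d (p + q).
Proof. by move=> hp /homN hq; rewrite -[q]opprK; apply: homB. Qed.

Lemma homM d e p q : hom d p -> hom e q -> hom (d + e) (p * q).
Proof.
move=> hp hq; elim: hp => {d p} [|d p p' _ IH _ IH'|d v p _ IH].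
- by rewrite mul1r.
- by rewrite mulrBl; apply: homB.
- by rewrite -mulrA addSn; apply: homX.
Qed.

Lemma hom_ev d s p : (forall v, hom 1 (s v)) -> hom d p -> hom d (ev s p).
Proof.
move=> hs; elim=> {d p} [|d p p' _ IH _ IH'|d v p _ IH].
- by rewrite rmorph1; apply: hom1.
- by rewrite rmorphB; apply: homB.
- by rewrite rmorphM ev_var -add1n; apply: homM.
Qed.

(** * Bounds on the [x] variables, and insertion of a letter *)

Definition kill_x n v := if v.1 || (v.2 < n)%N then x v else 0.

(* [bnd n p]: no [x_j] with [n <= j] occurs in [p]. *)
Definition bnd n p := ev (kill_x n) p = p.

Lemma bnd_ext n s s' p :
  bnd n p -> (forall v, v.1 || (v.2 < n)%N -> s v = s' v) -> ev s p = ev s' p.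
Proof.
move=> <- eq_s; rewrite !ev_comp; apply: ev_ext => v; rewrite /kill_x.
by case: ifP => [/eq_s|_]; rewrite ?rmorph0 // !ev_var.
Qed.

Lemma bnd_id n s p :
  bnd n p -> (forall v, v.1 || (v.2 < n)%N -> s v = x v) -> ev s p = p.
Proof. by move=> bp eq_s; rewrite (bnd_ext bp eq_s) ev_id. Qed.

Lemma bnd_ev m n s p :
  bnd m p -> (forall v, v.1 || (v.2 < m)%N -> bnd n (s v)) -> bnd n (ev s p).
Proof. by move=> bp bs; rewrite /bnd ev_comp; apply: bnd_ext bp bs. Qed.

Lemma bnd0 n : bnd n 0. Proof. exact: rmorph0. Qed.
Lemma bnd1 n : bnd n 1. Proof. exact: rmorph1. Qed.

Lemma bndB n p q : bnd n p -> bnd n q -> bnd n (p - q).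
Proof. by rewrite /bnd rmorphB => -> ->. Qed.

Lemma bndD n p q : bnd n p -> bnd n q -> bnd n (p + q).
Proof. by rewrite /bnd rmorphD => -> ->. Qed.

Lemma bndM n p q : bnd n p -> bnd n q -> bnd n (p * q).
Proof. by rewrite /bnd rmorphM => -> ->. Qed.

Lemma bnd_var n v : v.1 || (v.2 < n)%N -> bnd n (x v).
Proof. by move=> vn; rewrite /bnd ev_var /kill_x vn. Qed.

Lemma bndXB n i k : (i < n)%N -> bnd n (X i - T k).
Proof. by move=> ltin; apply: bndB; apply: bnd_var; rewrite //= ltin. Qed.

Lemma bnd_le m n p : (m <= n)%N -> bnd m p -> bnd n p.
Proof.
move=> le_mn bp; apply: bnd_id bp _ => v vm; rewrite /kill_x ifT //.
by case: v.1 vm => //= vm; apply: leq_trans le_mn.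
Qed.

Lemma bnd_div n i k q : (i < n)%N -> bnd n ((X i - T k) * q) -> bnd n q.
Proof.
by move=> ltin; rewrite /bnd rmorphM (bndXB k ltin) => /mulIXB.
Qed.

Lemma bnd_exists p : exists n, bnd n p.
Proof.
elim/var_ind: p => [|p q [m bp] [n bq]|v p [m bp]].
- by exists 0%N; apply: bnd1.
- by exists (maxn m n); apply: bndB; [apply: bnd_le bp|apply: bnd_le bq];
    rewrite ?leq_maxl ?leq_maxr.
- exists (maxn v.2.+1 m); apply: bndM; last by apply: bnd_le bp; apply: leq_maxr.
  by apply: bnd_var; rewrite leq_maxl orbT.
Qed.

(* [Rminus i] is evaluation at [insert i (T i)], [Rplus i] at [insert i.+1 (T i)]. *)
Definition insert i u v := if v.1 then x v else
  if (v.2 < i)%N then x v else if v.2 == i then u else X v.2.-1.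

Lemma insert_id n i u p : bnd n p -> (n <= i)%N -> ev (insert i u) p = p.
Proof.
move=> bp le_ni; apply: bnd_id bp _ => -[[] k] //=; rewrite /insert /= => ltkn.
by rewrite (leq_trans ltkn le_ni).
Qed.

Lemma bnd_insert n i u p :
  bnd n.+1 p -> (i <= n)%N -> bnd n u -> bnd n (ev (insert i u) p).
Proof.
move=> bp le_in bu; apply: bnd_ev bp _ => -[[] k] /=; rewrite /insert /= => ltk.
  exact: bnd_var.
case: ltnP => [ltki|le_ik]; first by apply: bnd_var => /=; lia.
by case: eqP => // neq_ki; apply: bnd_var => /=; lia.
Qed.

Lemma hom_insert d i k p : hom d p -> hom d (ev (insert i (T k)) p).
Proof.
by apply: hom_ev => v; rewrite /insert; do 3?[case: ifP => _]; apply: homx.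
Qed.

(** Both sides evaluate [p] at the sequence with [T l] at index [i] and [T k] at index [j.+1]: an
    insertion at [i <= j] pushes the other letter up by one. *)
Lemma insert_insert i j k l p : (i <= j)%N ->
  ev (insert j (T k)) (ev (insert i (T l)) p) =
  ev (insert i (T l)) (ev (insert j.+1 (T k)) p).
Proof.
move=> le_ij; rewrite !ev_comp; apply: ev_ext => -[b r]; rewrite /insert /=.
case: b; rewrite ?ev_var //=.
have [ltri|ltir|->] := ltngtP r i; last first.
- by rewrite ifT ?ltnS // !ev_var /= ltnn eqxx.
- case: (ltnP r j.+1) => [ltrj|lejr]; rewrite ?ev_var /=.
    by rewrite ifT; [rewrite ifF ?ifF //; lia|lia].
  rewrite ifF; last by lia.
  have [->|neq] := eqVneq r j.+1; first by rewrite /= eqxx ev_var.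
  by rewrite ifF ?ev_var /= ?ifF //; lia.
- by rewrite ifT ?ev_var /= ?ltri ?ifT //; lia.
Qed.

(** * Difference quotients and their compatibility *)

Definition Erel i u p q :=
  ev (insert i.+1 u) p - ev (insert i u) p = (X i - u) * q.

Lemma ErelB i u p p' q q' :
  Erel i u p q -> Erel i u p' q' -> Erel i u (p - p') (q - q').
Proof. by rewrite /Erel !rmorphB mulrBr => <- <-; ring. Qed.

Lemma ErelD i u p p' q q' :
  Erel i u p q -> Erel i u p' q' -> Erel i u (p + p') (q + q').
Proof. by rewrite /Erel !rmorphD mulrDr => <- <-; ring. Qed.

Lemma Erel_bnd n i u p : bnd n p -> (n <= i)%N -> Erel i u p 0.
Proof.
move=> bp le_ni; rewrite /Erel !(insert_id _ bp) ?subrr ?mulr0 //.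
exact: leqW.
Qed.

Lemma Erel_inj i k p q q' : Erel i (T k) p q -> Erel i (T k) p q' -> q = q'.
Proof. by rewrite /Erel => -> /mulIXB. Qed.

(** Twisted Leibniz rule, from [a' * b' - a * b = (a' - a) * b' + a * (b' - b)]. *)
Lemma ErelM i u p p' q q' : Erel i u p q -> Erel i u p' q' ->
  Erel i u (p * p') (q * ev (insert i.+1 u) p' + ev (insert i u) p * q').
Proof.
rewrite /Erel !rmorphM mulrDr mulrA => <-.
by rewrite [_ * (_ * q')]mulrCA => <-; ring.
Qed.

(** The quotient is 1 for [x_i], -1 for [x_(i+1)] and 0 for every other variable. *)
Lemma Erel_var i u v : exists2 c, Erel i u (x v) c & hom 0 c.
Proof.
case: v => b r; rewrite /Erel !ev_var /insert /=.
case: b; first by exists 0; [rewrite subrr mulr0|apply: hom0].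
have [ltri|ltir|->] := ltngtP r i.
- by exists 0; [rewrite ltnS (ltnW ltri) subrr mulr0|apply: hom0].
- rewrite ltnS leqNgt ltir /=; case: eqP => [->|_] /=.
    by exists (-1); [ring|apply/homN/hom1].
  by exists 0; [rewrite subrr mulr0|apply: hom0].
- by exists 1; [rewrite ltnSn mulr1|apply: hom1].
Qed.

Lemma Erel_exists i u p : exists q, Erel i u p q.
Proof.
elim/var_ind: p => [|p p' [q Eq] [q' Eq']|v p [q Eq]].
- by exists 0; rewrite /Erel !rmorph1 subrr mulr0.
- by exists (q - q'); apply: ErelB.
- by have [c Ec _] := Erel_var i u v; eexists; apply: ErelM Ec Eq.
Qed.

(** Since [d.-1] is 0 also for [d = 0], the vanishing of [q] in degree 0 is carried along; the
    Leibniz term that multiplies [q] by a variable relies on it. *)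
Lemma Erel_hom i k d p q :
  hom d p -> Erel i (T k) p q -> hom d.-1 q /\ (d = 0%N -> q = 0).
Proof.
move=> hp; suff [q' Eq' hq'] : exists2 q', Erel i (T k) p q' &
    hom d.-1 q' /\ (d = 0%N -> q' = 0).
  by move/(Erel_inj Eq') <-.
elim: hp => {d p q} [|d p p' _ [q Eq [hq q0]] _ [q' Eq' [hq' q0']]|
                      d v p hp [q Eq [hq q0]]].
- by exists 0; [rewrite /Erel !rmorph1 subrr mulr0|split=> //; apply: hom0].
- exists (q - q'); [exact: ErelB|split; first exact: homB].
  by move=> d0; rewrite q0 // q0' // subrr.
- have [c Ec hc] := Erel_var i (T k) v.
  exists (c * ev (insert i.+1 (T k)) p + ev (insert i (T k)) (x v) * q).
    exact: ErelM.
  split=> //=; apply: homD.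
    by rewrite -[d]add0n; apply/homM/hom_insert.
  case: d {hp} hq q0 => [_ -> //|d hq _]; first by rewrite mulr0; apply: hom0.
  by rewrite -add1n; apply: homM => //; apply/hom_insert/homx.
Qed.

Lemma E_proof i p : exists q,
  ev (insert i.+1 (T i)) p - ev (insert i (T i)) p == (X i - T i) * q.
Proof. by have [q Eq] := Erel_exists i (T i) p; exists q; apply/eqP. Qed.

Definition E i p := xchoose (E_proof i p).

Lemma EP i p : Erel i (T i) p (E i p).
Proof. by apply/eqP; apply: (xchooseP (E_proof i p)). Qed.

(* After inserting [t_i], position [j+1] and the letter [t_(j+1)] move to index
   [j]; hence the mismatch between [j] and [j.+1]. *)
Definition compat (g : nat -> A) := forall i j, (i < j)%N ->
  exists2 q, Erel j (T j.+1) (g i) q & Erel i (T i) (g j.+1) q.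

Lemma compatB g h : compat g -> compat h -> compat (fun i => g i - h i).
Proof.
move=> cg ch i j ltij; have [q Eq Eq'] := cg i j ltij.
have [r Er Er'] := ch i j ltij.
by exists (q - r); apply: ErelB.
Qed.

Lemma compatE f : compat (E^~ f).
Proof.
move=> i j ltij; have [q Eq] := Erel_exists j (T j.+1) (E i f).
(* Once both linear factors are multiplied in, each side is an alternating sum of four double
   insertions into [f], matched by [insert_insert]. *)
exists q => //; apply: (@mulIXB j j.+1); rewrite mulrCA -Eq.
have pull a : (i < a)%N -> (X i - T i) * ev (insert a (T j.+1)) (E i f) =
    ev (insert a (T j.+1)) (ev (insert i.+1 (T i)) f - ev (insert i (T i)) f).
  by move=> ltia; rewrite EP rmorphM (insert_id _ (bndXB i (ltnSn i)) ltia).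
(* An insertion at [a <= j] sends [X j.+1] to [X j], so the factor is the image of
   [X j.+1 - T j.+1]. *)
have pull' a : (a <= j)%N -> (X j - T j.+1) * ev (insert a (T i)) (E j.+1 f) =
    ev (insert a (T i))
      (ev (insert j.+2 (T j.+1)) f - ev (insert j.+1 (T j.+1)) f).
  move=> leaj; rewrite EP rmorphM rmorphB !ev_var /insert /=.
  by rewrite ifF ?ifF //; lia.
rewrite !mulrBr !pull ?pull' ?leqW // ?(ltnW ltij) // !rmorphB.
rewrite !(@insert_insert _ j) ?(@insert_insert _ j.+1) ?leqW ?(ltnW ltij) //.
by ring.
Qed.

Fixpoint solve n (g : nat -> A) : A :=
  if n is m.+1 then
    let f := (X m - T m) * g m in f + solve m (fun i => g i - E i f)
  else 0.

(** The bounds are those satisfied by [E_i f] when [f] lives in [x_0, ..., x_(n-1)]: for [i.+1 < n]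
    both insertions use up one variable, while at [i = n-1] the upper one fixes [f], so [x_(n-1)]
    may survive. *)
Lemma solveP n d g :
    (forall i, (n <= i)%N -> g i = 0) -> (forall i, bnd n (g i)) ->
    (forall i, (i.+1 < n)%N -> bnd n.-1 (g i)) ->
    (forall i, hom d (g i)) -> compat g ->
  [/\ bnd n (solve n g), hom d.+1 (solve n g) &
      forall i, Erel i (T i) (solve n g) (g i)].
Proof.
elim: n g => [|n IH] g g0 bg bg' hg cg /=.
  split=> [||i]; [exact: bnd0|exact: hom0|].
  by rewrite g0 //; apply: Erel_bnd (bnd0 0) _.
set f := _ * g n; set h := fun i => g i - E i f.
have bf : bnd n.+1 f by apply: bndM => //; apply: bndXB.
have hf : hom d.+1 f.
  by rewrite -add1n; apply: homM => //; apply: homB; apply: homx.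
have hE i : hom d (E i f) by case: (Erel_hom hf (EP i f)).
(* Insertion at [n.+1] fixes [f]; insertion of [T n] at [n] kills its factor [X n - T n]. *)
have En : E n f = g n.
  apply/esym/(Erel_inj _ (EP n f)); rewrite /Erel (insert_id _ bf) //.
  by rewrite {2}/f rmorphM rmorphB !ev_var /insert /= ltnn eqxx subrr mul0r subr0.
have h0 i : (n <= i)%N -> h i = 0.
  rewrite leq_eqVlt => /orP[/eqP<-|ltni]; first by rewrite /h En subrr.
  by rewrite /h g0 // (Erel_inj (EP i f) (Erel_bnd _ bf ltni)) subrr.
have bE i : (i < n)%N -> bnd n (E i f).
  move=> ltin; apply: (bnd_div (i := i) (k := i)) => //; rewrite -EP.
  by apply: bndB; apply: bnd_insert => //; rewrite ?(ltnW ltin) //; apply: bnd_var.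
have [||||| br hr Er] := IH h.
- exact: h0.
- move=> i; have [/h0->|ltin] := leqP n i; first exact: bnd0.
  by apply: bndB; [apply: bg'|apply: bE].
- case: n => [//|n] in f h bf hf hE En h0 bE bg bg' g0 IH * => i /= ltin.
  have [q Eq Eq'] := cg i n ltin.
  (* By compatibility [g i - E i f] is [g i] with [x_n] set to [t_(n+1)]. *)
  suff Ei : E i f =
      ev (insert n.+1 (T n.+1)) (g i) - ev (insert n (T n.+1)) (g i).
    rewrite /h Ei (insert_id _ (bg' i _)) //; last exact: leqW.
    rewrite opprB addrC subrK; apply: bnd_insert; [|by []|exact: bnd_var].
    by apply: bg'; apply: leqW.
  (* Inserting [T i] at [i] or [i.+1] turns the factor [X n.+1 - T n.+1] of [f] into [X n - T n.+1],
     and [q] is the quotient of the other factor [g n.+1]. *)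
  rewrite Eq; apply: Erel_inj (EP i f) _; rewrite /Erel.
  rewrite {1 2}/f !rmorphM mulrCA -Eq' mulrBr; congr (_ * _ - _ * _).
    by rewrite rmorphB !ev_var /insert /= ifF ?ifF //; lia.
  by rewrite rmorphB !ev_var /insert /= ifF ?ifF //; lia.
- by move=> i; apply: homB.
- by apply: compatB cg _; apply: compatE.
split; first by apply: bndD => //; apply: bnd_le br.
  exact: homD.
move=> i; have -> : g i = E i f + h i by rewrite addrC subrK.
exact: ErelD (EP i f) (Er i).
Qed.

Lemma bnd0_Erel p : (forall i, Erel i (T i) p 0) -> bnd 0 p.
Proof.
move=> Ep; have [n] := bnd_exists p; elim: n => // n IH bp; apply: IH.
have /eqP := Ep n; rewrite /Erel mulr0 subr_eq0 (insert_id _ bp) // => /eqP->.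
by apply: bnd_insert => //; apply: bnd_var.
Qed.

(** * Evaluation at [x = t], and omission of a variable [t_i] *)

Definition diag v := T v.2.

Lemma diag_id p : bnd 0 p -> ev diag p = p.
Proof. by move=> bp; apply: bnd_id bp _ => -[[] k]. Qed.

Lemma bnd_diag p : bnd 0 (ev diag p).
Proof.
by have [n bp] := bnd_exists p; apply: bnd_ev bp _ => v _; apply: bnd_var.
Qed.

Lemma Erel_diag_inj p p' (q : nat -> A) :
    (forall i, Erel i (T i) p (q i)) -> (forall i, Erel i (T i) p' (q i)) ->
  ev diag p = ev diag p' -> p = p'.
Proof.
move=> Ep Ep' eq_pp'; apply/eqP; rewrite -subr_eq0; apply/eqP.
rewrite -(@diag_id (p - p')) ?rmorphB ?eq_pp' ?subrr //.
by apply: bnd0_Erel => i; rewrite -(subrr (q i)); apply: ErelB.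
Qed.

Definition hat i v :=
  if v.1 then if (v.2 < i)%N then T v.2 else T v.2.+1 else X v.2.

Lemma bnd_hat n i p : bnd n p -> bnd n (ev (hat i) p).
Proof.
move=> bp; apply: bnd_ev bp _ => -[[] k] kn; rewrite /hat /=.
  by case: ifP => _; apply: bnd_var.
exact: bnd_var.
Qed.

Lemma hom_hat d i p : hom d p -> hom d (ev (hat i) p).
Proof. by apply: hom_ev => v; rewrite /hat; do 2?[case: ifP => _]; apply: homx. Qed.

(** Both sides omit [t_i] and [t_(j+1)]: once [t_i] is gone, [t_(j+1)] has index [j]. *)
Lemma hat_hat i j p : (i <= j)%N ->
  ev (hat i) (ev (hat j) p) = ev (hat j.+1) (ev (hat i) p).
Proof.
move=> le_ij; rewrite !ev_comp; apply: ev_ext => -[[] k]; rewrite /hat /=.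
  case: (ltnP k i) => [ltki|leik]; rewrite ?ev_var /=.
    by rewrite ifT ?ev_var /= ?ltki ?ifT //; lia.
  rewrite [(k.+1 < _)%N]ltnS; case: (ltnP k j) => [ltkj|lejk]; rewrite ev_var /=.
    by rewrite ltnNge leik.
  by rewrite ifF //; lia.
by rewrite !ev_var.
Qed.

(** Omitting [t_i] replaces [t_k] by [t_(k+1)] exactly when [i <= k], which produces the letter
    [T j.+1] in [compat]. *)
Lemma Erel_hat i k p q : Erel k (T k) p q ->
  Erel k (T (bump i k)) (ev (hat i) p) (ev (hat i) q).
Proof.
have hatT : hat i (true, k) = T (bump i k).
  by rewrite /hat /bump /= ltnNge; case: leqP.
have insert_hat a : ev (insert a (T (bump i k))) (ev (hat i) p) =
                 ev (hat i) (ev (insert a (T k)) p).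
  rewrite !ev_comp; apply: ev_ext => -[[] r]; rewrite /insert /=.
    by rewrite ev_var /hat /=; case: ifP => _; rewrite ev_var.
  rewrite ev_var /=; case: ifP => _; rewrite ?ev_var //.
  by case: ifP => _; rewrite ev_var // hatT.
move/(congr1 (ev (hat i))); rewrite rmorphB rmorphM !rmorphB !ev_var hatT.
by rewrite /Erel !insert_hat.
Qed.

(** * Double forest polynomials *)

(** From this index on every [E_i] kills the polynomial of [F], so only the [x_i] below it can
    occur. *)
Definition xwidth (F : forest) := \max_(i <- qdes F) i.+1.

Lemma qdes_xwidth F i : i \in qdes F -> (i < xwidth F)%N.
Proof. by move=> iF; apply: (@leq_bigmax_seq _ _ _ succn). Qed.

Lemma xwidth_le F n : (forall i, i \in qdes F -> (i < n)%N) -> (xwidth F <= n)%N.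
Proof. by move=> qF; apply/bigmax_leqP_seq => i /qF. Qed.

(** Elements of [qdes (fdel F i)] beyond [i] come from elements of [qdes F] one larger; the others
    are bounded by [i < n]. *)
Lemma xwidth_fdel F i n : i \in qdes F -> (i < n)%N -> (xwidth F <= n.+1)%N ->
  (xwidth (fdel F i) <= n)%N.
Proof.
move=> iF ltin leFn; apply: xwidth_le => k kF.
have [leki|ltik] := leqP k i; first exact: leq_ltn_trans ltin.
rewrite -ltnS; apply: leq_trans leFn; apply: qdes_xwidth.
by rewrite -(qdes_fdel_gt iF).
Qed.

(* Meant for [N = fsize F]. *)
Fixpoint forest_poly_rec N (F : forest) : A :=
  if N is N'.+1 then
    let f := solve (xwidth F)
      (fun i => if i \in qdes F
                then ev (hat i) (forest_poly_rec N' (fdel F i)) else 0) in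
    f - ev diag f
  else 1.

Lemma Erel0 i u : Erel i u 0 0.
Proof. exact: Erel_bnd (bnd0 0) _. Qed.

Lemma forest_poly_recP N F : fsize F = N ->
  [/\ bnd (xwidth F) (forest_poly_rec N F), hom N (forest_poly_rec N F),
      ev diag (forest_poly_rec N F) = (if empty_forest F then 1 else 0) &
      forall i, Erel i (T i) (forest_poly_rec N F)
        (if i \in qdes F
         then ev (hat i) (forest_poly_rec N.-1 (fdel F i)) else 0)].
Proof.
elim: N F => [|N IH] F sF /=; rewrite empty_forestE sF.
  split=> [|||i]; [exact: bnd1|exact: hom1|by rewrite rmorph1|].
  by case: ifP => [/fsize_fdel|_]; [rewrite sF|apply: Erel_bnd (bnd1 0) _].
set g := fun i => _; set n := xwidth F.
have sFi i : i \in qdes F -> fsize (fdel F i) = N.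
  by move=> /fsize_fdel; rewrite sF => -[].
have [||||| bf hf Ef] := @solveP n N g.
- move=> i le_ni; rewrite /g; case: ifP => // /qdes_xwidth.
  by rewrite ltnNge le_ni.
- move=> i; rewrite /g; case: ifP => [iF|_]; last exact: bnd0.
  have [bi _ _ _] := IH _ (sFi _ iF); apply: bnd_hat; apply: bnd_le bi.
  by apply: xwidth_fdel => //; apply: qdes_xwidth.
- move=> i ltin; rewrite /g; case: ifP => [iF|_]; last exact: bnd0.
  have [bi _ _ _] := IH _ (sFi _ iF); apply: bnd_hat; apply: bnd_le bi.
  by apply: xwidth_fdel => //; rewrite -/n; lia.
- move=> i; rewrite /g; case: ifP => [iF|_]; last exact: hom0.
  by have [_ hi _ _] := IH _ (sFi _ iF); apply: hom_hat.
- move=> i j ltij; rewrite /g.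
  have Ei : i \in qdes F ->
      Erel j (T j.+1) (ev (hat i) (forest_poly_rec N (fdel F i)))
      (if j.+1 \in qdes F then
         ev (hat i) (ev (hat j) (forest_poly_rec N.-1 (fdel (fdel F i) j)))
       else 0).
    move=> iF; have [_ _ _ /(_ j)/(Erel_hat i)] := IH _ (sFi _ iF).
    rewrite qdes_fdel_gt // /bump (ltnW ltij).
    by case: ifP => _; rewrite ?rmorph0.
  have Ej : j.+1 \in qdes F ->
      Erel i (T i) (ev (hat j.+1) (forest_poly_rec N (fdel F j.+1)))
      (if i \in qdes F then
         ev (hat j.+1)
           (ev (hat i) (forest_poly_rec N.-1 (fdel (fdel F j.+1) i)))
       else 0).
    move=> jF; have [_ _ _ /(_ i)/(Erel_hat j.+1)] := IH _ (sFi _ jF).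
    rewrite qdes_fdel_lt // /bump leqNgt ltnS (ltnW ltij).
    by case: ifP => _; rewrite ?rmorph0.
  (* If both deletions are possible, the two quotients agree by [fdel_fdel] and [hat_hat]; otherwise
     both are 0. *)
  case iF: (i \in qdes F) Ei Ej; case jF: (j.+1 \in qdes F) => Ei Ej.
  + eexists; first exact: Ei.
    by rewrite fdel_fdel // hat_hat ?(ltnW ltij) //; apply: Ej.
  + by exists 0; [exact: Ei|exact: Erel0].
  + by exists 0; [exact: Erel0|exact: Ej].
  + by exists 0; exact: Erel0.
set f := solve n g in bf hf Ef *; have bd := bnd_diag f; split=> [|||i].
- by apply: bndB => //; apply: bnd_le bd.
- by apply: homB => //; apply: hom_ev hf => v; apply: homx.
- by rewrite rmorphB (diag_id bd) subrr.
- by rewrite -[Z in Erel _ _ _ Z]subr0; apply: ErelB (Ef i) (Erel_bnd _ bd _).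
Qed.

Definition forest_poly F := forest_poly_rec (fsize F) F.

Definition family (Q : forest -> A) :=
  (forall F, ev diag (Q F) = (if empty_forest F then 1 else 0)) /\
  (forall F i, Erel i (T i) (Q F)
     (if i \in qdes F then ev (hat i) (Q (fdel F i)) else 0)).

Lemma forest_poly_family : family forest_poly.
Proof.
split=> F; first by have [_ _ ->] := forest_poly_recP (erefl (fsize F)).
move=> i; have [_ _ _ /(_ i)] := forest_poly_recP (erefl (fsize F)).
by case: ifP => // iF; rewrite /forest_poly (fsize_fdel iF).
Qed.

Lemma forest_poly_hom F : hom (fsize F) (forest_poly F).
Proof. by have [_ hF _ _] := forest_poly_recP (erefl (fsize F)). Qed.

Lemma family_unique Q Q' : family Q -> family Q' -> Q =1 Q'.
Proof.
move=> [dQ EQ] [dQ' EQ'] F; have [N] := ubnP (fsize F); elim: N F => // N IH F ltF.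
apply: (Erel_diag_inj (EQ F)); last by rewrite dQ dQ'.
move=> i; case: ifP (EQ' F i) => // iF; rewrite IH //.
by rewrite (fsize_fdel iF) in ltF.
Qed.

End Reconstruction.

(** * The ring of polynomials in [x] and [t] *)

(** The inner product of [subst], isolated so that [subst s] unfolds to an instance of [mmap] and
    inherits its ring morphism structure. *)
Definition mon_eval (s : var_t -> xtpoly) (m : cmonom var_t) : xtpoly :=
  \prod_(v <- finsupp (m : {fsfun of _ : var_t => 0%N})) s v ^+ (m v).

(** Allows products of different monomials to be taken over a common index set. *)
Lemma mon_evalEw s (m : cmonom var_t) (d : {fset var_t}) :
  (finsupp (m : {fsfun of _ : var_t => 0%N}) `<=` d)%fset ->
  mon_eval s m = \prod_(v <- d) s v ^+ m v.
Proof.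
move=> le; rewrite [LHS](big_fset_incl _ le) //.
by move=> v vd; rewrite -cmE_eq0 => /eqP->.
Qed.

Lemma mon_eval_mmorphism s : mmorphism (mon_eval s).
Proof.
split; last by rewrite /mon_eval mdom1 big_seq_fset0.
move=> m1 m2.
rewrite (mon_evalEw s (m := m1) (d := (finsupp m1 `|` finsupp m2)%fset)); last first.
  exact: fsubsetUl.
rewrite (mon_evalEw s (m := m2) (d := (finsupp m1 `|` finsupp m2)%fset)); last first.
  exact: fsubsetUr.
rewrite /mon_eval mdomD -big_split /=; apply: eq_bigr => v _.
by rewrite cmM exprD.
Qed.

HB.instance Definition _ s :=
  isMultiplicative.Build (cmonom var_t) xtpoly (mon_eval s) (mon_eval_mmorphism s).

HB.instance Definition _ s := GRing.RMorphism.copy (subst s)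
  (mmap (@malgC (cmonom var_t) int) (mon_eval s)).

Lemma subst_var s v : subst s (var v) = s v.
Proof.
by rewrite [LHS]mmapU mul1r /mon_eval mdomU big_seq_fset1 cmUU expr1.
Qed.

Lemma cmonom_ucm_ind (K : cmonom var_t -> Prop) :
  K mone -> (forall v m, K m -> K (mmul (ucm v) m)) -> forall m, K m.
Proof.
move=> K1 KM m; have [n] := ubnP (mdeg m); elim: n m => // n IH m.
have [->//|m_neq1] := eqVneq m mone.
have [v vm] : exists v, m v != 0%N.
  have: finsupp m != fset0.
    apply: contraNneq m_neq1 => m0.
    by rewrite -mdeg_eq0 mdegE m0 big_seq_fset0.
  by case/fset0Pn => v; rewrite -cmE_neq0 => ?; exists v.
have -> : m = mmul (ucm v) (divcm m (ucm v)).
  apply/eqP/cmP => w; rewrite cmM divcmE cmU.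
  by case: eqP => [<-|_]; rewrite ?subnKC ?lt0n ?subn0.
by rewrite mdegM mdegU => lt_m; apply/KM/IH.
Qed.

Lemma monalgUM (c : int) (v : var_t) m :
  << c *g mmul (ucm v) m >> = var v * << c *g m >> :> xtpoly.
Proof. by rewrite [RHS]fgmulUU mul1r. Qed.

(** Integer constants arise from 1 by subtraction, and monomials from constants by multiplication
    with variables. *)
Lemma xtpoly_var_ind (K : xtpoly -> Prop) :
    K 1 -> (forall p q, K p -> K q -> K (p - q)) ->
    (forall v p, K p -> K (var v * p)) ->
  forall p, K p.
Proof.
move=> K1 KB KM p.
have K0 : K 0 by rewrite -(subrr (1 : xtpoly)); apply: KB.
have KN q : K q -> K (- q) by move=> Kq; rewrite -sub0r; apply: KB.
have KD q r : K q -> K r -> K (q + r).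
  by move=> Kq /KN Kr; rewrite -[r]opprK; apply: KB.
rewrite [p]monalgE; apply: (big_ind K K0 KD) => m _.
move: (p@_m) => c; elim/cmonom_ucm_ind: m => [|v m IH]; last first.
  by rewrite monalgUM; apply: KM.
have KnC (n : nat) : K (n%:Z)%:MP.
  elim: n => [|n IH]; first by rewrite malgC0E.
  by rewrite -addn1 PoszD monalgUD; exact: (KD _ _ IH K1).
by case: c => n; rewrite ?NegzE ?monalgUN; [|apply: KN]; apply: KnC.
Qed.

Lemma mulIvar v (p : xtpoly) : var v * p = 0 -> p = 0.
Proof.
(* Dividing every monomial by [v], with truncated exponents, is additive and a left inverse of
   multiplication by [var v]. *)
pose D := mmap (@malgC (cmonom var_t) int)
  (fun m => << divcm m (ucm v) >> : xtpoly).
have DU c m : D (var v * << c *g m >>) = << c *g m >>.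
  rewrite -(monalgUM c v m) /D mmapU [LHS]fgmulUU mulr1 [mmul mone _]mul1m.
  suff -> : divcm (mmul (ucm v) m) (ucm v) = m by [].
  by apply/eqP/cmP => w; rewrite divcmE cmM addKn.
have DK : D (var v * p) = p.
  rewrite [p]monalgE mulr_sumr /D raddf_sum; apply: eq_bigr => m _; exact: DU.
by move=> vp0; rewrite -DK vp0 /D raddf0.
Qed.

Lemma hom_homogeneous d p : hom var d p -> homogeneous p.
Proof.
move=> hp; exists d; elim: hp => {d p} [|d p q _ IHp _ IHq|d v p _ IH] m.
- by rewrite -mcoeff_neq0 mcoeff1; case: (m =P mone) => [->|]; rewrite ?mdeg1 ?eqxx.
- by move/(fsubsetP (msuppB_le p q)); rewrite inE => /orP[/IHp|/IHq].
- case/msuppM_le => m1 [m2] [+ /IH<- ->]; rewrite [msupp (var v)]msuppU1.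
  by rewrite in_fset1 => /eqP->; rewrite mdegM mdegU add1n.
Qed.

Theorem theorem4p2 :
  exists P : forest -> xtpoly,
    forest_family P /\
    (forall P' : forest -> xtpoly, forest_family P' -> forall F, P' F = P F).
Proof.
pose ev s : {rmorphism xtpoly -> xtpoly} := subst s.
have subst_ext := ev_ext (ev := ev) subst_var xtpoly_var_ind.
(* The tests [k <= i] and [k < i.+1] agree by computation. *)
have RpE i p : Rplus i p = ev (insert var i.+1 (T i)) p
  by apply: subst_ext => -[[] k].
have RmE i p : Rminus i p = ev (insert var i (T i)) p
  by apply: subst_ext => -[[] k].
have EE i p q : Erel var ev i (T i) p q = E_eq i p q by rewrite /E_eq RpE RmE.
have familyE Q : family var ev Q <->
    (forall F, sub_xt (Q F) = (if empty_forest F then 1 else 0)) /\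
    (forall F i, E_eq i (Q F)
       (if i \in qdes F then sub_that i (Q (fdel F i)) else 0)).
  split=> -[dQ EQ]; split; try exact: dQ.
    move=> F i; rewrite -EE; exact: EQ.
  move=> F i; rewrite EE; exact: EQ.
have P_fam := forest_poly_family (ev := ev) subst_var xtpoly_var_ind mulIvar.
exists (forest_poly (ev := ev) subst_var xtpoly_var_ind); split.
  split; last exact: (proj1 (familyE _) P_fam).
  move=> F; apply: hom_homogeneous.
  exact: forest_poly_hom subst_var xtpoly_var_ind mulIvar F.
move=> Q [_ /(proj2 (familyE _)) Q_fam] F.
exact: (family_unique subst_var xtpoly_var_ind Q_fam P_fam F).
Qed.
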